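(* Let $(X,c)$ be an $\mathbb{M}$-algebra. Then $X$, endowed with its associated vector space structure (addition $x+y=c(\delta_x+\delta_y)$ and scalar multiplication $a\cdot x=c(a\delta_x)$), is a convex bornological vector space. Hence the functor $\mathbf{BornMeas}^{\mathbb{M}}\to\mathbb{R}\text{-}\mathbf{Vect}$ that equips each $\mathbb{M}$-algebra with this associated vector space structure factors through the category $\mathbb{R}\text{-}\mathbf{ConvBvs}$ of convex bornological vector spaces and bornological linear maps.
   Context: A bornology on a set $X$ is a collection $\mathcal{B}X$ of subsets of $X$ (the bounded subsets) that is closed under taking subsets and finite unions (in particular contains $\emptyset$) and contains all singletons. A map is bornological if images of bounded sets are bounded; $\mathbf{Born}$ is the category of sets with a bornology and bornological maps. A measurable bornological set is a set equipped with both a bornology and a sigma-algebra (no compatibility is required); $\mathbf{BornMeas}$ is the category of these with maps that are measurable and bornological. $\mathbb{R}$ carries its Borel sigma-algebra and usual bornology. A subset $A\subseteq X$ carries the sigma-algebra $\{A\cap E\mid E\subseteq X\text{ measurable}\}$ and the bornology of those subsets of $A$ bounded in $X$. For a measurable space $X$, $SX$ is the real vector space of all finite signed measures on $X$, with the sigma-algebra generated by the evaluation maps $\mathrm{Ev}_E:\mu\mapsto\mu(E)$ ($E$ measurable) and the total variation norm $\|\mu\|=|\mu|(X)$. For $f:X\to Y$ measurable, $Sf(\mu)$ is the direct image measure $F\mapsto\mu(f^{-1}(F))$. $\mu\in SX$ is supported by a subset $A\subseteq X$ if it is the direct image, along the inclusion $A\hookrightarrow X$, of some measure in $SA$. The monad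 $\mathbb{M}=(M,\delta,\kappa)$ on $\mathbf{BornMeas}$: $MX$ is the set (a vector subspace of $SX$) of all $\mu\in SX$ supported by some bounded $B\subseteq X$, with sigma-algebra generated by the maps $\mathrm{Ev}_E:MX\to\mathbb{R}$ and bornology consisting of all subsets of the sets $M(B,X,\gamma)=\{\mu\in MX\mid\mu\text{ supported by }B,\ \|\mu\|\leqslant\gamma\}$ ($B\subseteq X$ bounded, $\gamma\geqslant0$); $Mf$ is the restriction of $Sf$; $\delta_X(x)=\delta_x$ is the Dirac measure; $(\kappa_X(\mathcal{M}))(E)=\int\mathrm{Ev}_E\,d\mathcal{M}$ for $\mathcal{M}\in MMX$. An $\mathbb{M}$-algebra is an Eilenberg-Moore algebra: $X\in\mathbf{BornMeas}$ with a $\mathbf{BornMeas}$-morphism $c:MX\to X$ such that $c\circ\delta_X=1_X$ and $c\circ Mc=c\circ\kappa_X$. An $\mathbb{M}$-homomorphism $(X,c)\to(Y,d)$ is a $\mathbf{BornMeas}$-morphism $\phi$ with $\phi\circ c=d\circ M\phi$; $\mathbf{BornMeas}^{\mathbb{M}}$ is the category of $\mathbb{M}$-algebras. The functor $\mathbf{BornMeas}^{\mathbb{M}}\to\mathbb{R}\text{-}\mathbf{Vect}$ is the identity on underlying sets and functions. A bornological vector space is a real vector space $V$ with a bornology for which addition $V\times V\to V$ and scalar multiplication $\mathbb{R}\times V\to V$ are bornological (products taken in $\mathbf{Born}$: a subset is bounded iff its projections are). It is convex if every bounded subset is contained in a convex bounded subset. *)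

(* Defs.v *)
From HB Require Import structures.
From mathcomp Require Import all_boot all_order all_algebra.
From mathcomp Require Import all_classical all_reals all_analysis.
From mathcomp Require Import measurable_realfun lra ring.

Set Implicit Arguments.
Unset Strict Implicit.
Unset Printing Implicit Defensive.

Import Order.TTheory GRing.Theory Num.Theory.
Import numFieldNormedType.Exports.

Local Open Scope classical_set_scope.
Local Open Scope ring_scope.

(* A charge of the library is a function on all subsets of [T] whose values on
   the non-measurable subsets are unconstrained.  They are required to be 0
   here, so that two signed measures are equal as soon as they agree on the
   measurable sets. *)
Record signed_measure d (T : measurableType d) (R : realType) := SignedMeasure {
  sm_charge :> {charge set T -> \bar R} ;
  sm_out : forall E, ~ measurable E -> sm_charge E = 0%E }.

Section signed_measure_theory.
Context d (T : measurableType d) (R : realType).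
Implicit Types mu nu : signed_measure T R.

Lemma sm_ext mu nu : (forall E, measurable E -> mu E = nu E) -> mu = nu.
Proof.
case: mu nu => [[mu [[m1] [m2] [m3]]] mo] [[nu [[n1] [n2] [n3]]] no] /= h.
have e : mu = nu.
  apply/funext => E; have [/h//|mE] := pselect (measurable E).
  by rewrite [LHS]mo// [RHS]no.
subst nu.
rewrite (Prop_irrelevance m1 n1) (Prop_irrelevance m2 n2).
rewrite (Prop_irrelevance m3 n3) in no *.
by rewrite (Prop_irrelevance mo no).
Qed.

Lemma sm_fin mu E : measurable E -> mu E \is a fin_num.
Proof. exact: fin_num_measure. Qed.

Lemma sm_of_charge_subproof (nu : {charge set T -> \bar R}) E :
  ~ measurable E -> crestr0 nu (@measurableT _ T) E = 0%E.
Proof. by move=> mE; rewrite /crestr0 memNset. Qed.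

Definition sm_of_charge (nu : {charge set T -> \bar R}) :=
  @SignedMeasure d T R (crestr0 nu (@measurableT _ T))
    (@sm_of_charge_subproof nu).

Lemma sm_of_chargeE (nu : {charge set T -> \bar R}) E :
  measurable E -> sm_of_charge nu E = nu E.
Proof. by move=> mE; rewrite /= /crestr0 mem_set// /crestr setIT. Qed.

HB.instance Definition _ := gen_eqMixin (signed_measure T R).
HB.instance Definition _ := gen_choiceMixin (signed_measure T R).

Definition sm_zero := sm_of_charge (@czero _ T R).
Definition sm_add mu nu := sm_of_charge (cadd mu nu).
Definition sm_scale (a : R) mu := sm_of_charge (cscale a mu).
Definition sm_opp mu := sm_scale (-1) mu.

Lemma sm_zeroE E : sm_zero E = 0%E.
Proof. by rewrite /= /crestr0; case: ifP. Qed.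

Lemma sm_addE mu nu E : sm_add mu nu E = (mu E + nu E)%E.
Proof.
have [mE|mE] := pselect (measurable E); first exact: sm_of_chargeE.
by rewrite !sm_out// adde0.
Qed.

Lemma sm_scaleE a mu E : sm_scale a mu E = (a%:E * mu E)%E.
Proof.
have [mE|mE] := pselect (measurable E); first exact: sm_of_chargeE.
by rewrite !sm_out// mule0.
Qed.

Lemma sm_addA : associative sm_add.
Proof. by move=> x y z; apply: sm_ext => E _; rewrite !sm_addE addeA. Qed.

Lemma sm_addC : commutative sm_add.
Proof. by move=> x y; apply: sm_ext => E _; rewrite !sm_addE addeC. Qed.

Lemma sm_add0 : left_id sm_zero sm_add.
Proof. by move=> x; apply: sm_ext => E _; rewrite sm_addE sm_zeroE add0e. Qed.

Lemma sm_addN : left_inverse sm_zero sm_opp sm_add.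
Proof.
move=> x; apply: sm_ext => E mE; rewrite sm_addE sm_zeroE sm_scaleE.
by rewrite EFinN mulN1e addeC subee// sm_fin.
Qed.

HB.instance Definition _ :=
  GRing.isZmodule.Build (signed_measure T R) sm_addA sm_addC sm_add0 sm_addN.

Lemma sm_scaleA a b mu : sm_scale a (sm_scale b mu) = sm_scale (a * b) mu.
Proof. by apply: sm_ext => E _; rewrite !sm_scaleE EFinM muleA. Qed.

Lemma sm_scale1 : left_id 1 sm_scale.
Proof. by move=> mu; apply: sm_ext => E _; rewrite sm_scaleE mul1e. Qed.

Lemma sm_scaleDr : right_distributive sm_scale +%R.
Proof.
move=> a mu nu; apply: sm_ext => E mE.
rewrite sm_scaleE [RHS]sm_addE [X in (_ * X)%E]sm_addE !sm_scaleE.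
by rewrite muleDr// fin_num_adde_defr// sm_fin.
Qed.

Lemma sm_scaleDl mu a b : sm_scale (a + b) mu = sm_scale a mu + sm_scale b mu.
Proof.
apply: sm_ext => E mE; rewrite [RHS]sm_addE !sm_scaleE EFinD.
by rewrite -(fineK (sm_fin mu mE)) -!EFinM -EFinD mulrDl.
Qed.

HB.instance Definition _ := GRing.Zmodule_isLmodule.Build R (signed_measure T R)
  sm_scaleA sm_scale1 sm_scaleDr sm_scaleDl.

Lemma smD mu nu E : (mu + nu) E = (mu E + nu E)%E. Proof. exact: sm_addE. Qed.

Lemma smZ a mu E : (a *: mu) E = (a%:E * mu E)%E. Proof. exact: sm_scaleE. Qed.

Lemma sm0 E : (0 : signed_measure T R) E = 0%E. Proof. exact: sm_zeroE. Qed.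

(* Any choice of Hahn decomposition gives the same Jordan decomposition on the
   measurable sets. *)
Definition hahn_sets mu : {PN : set T * set T | hahn_decomposition mu PN.1 PN.2}.
Proof.
by apply: cid; have [P [N PN]] := Hahn_decomposition mu; exists (P, N).
Qed.

Definition sm_pos mu := jordan_pos (svalP (hahn_sets mu)).
Definition sm_neg mu := jordan_neg (svalP (hahn_sets mu)).

Definition total_variation mu := charge_variation (svalP (hahn_sets mu)).

Definition sm_norm mu : R := fine (total_variation mu setT).

Definition sm_integral mu (f : T -> R) : R :=
  (\int[sm_pos mu]_x f x - \int[sm_neg mu]_x f x)%R.

Definition sm_dirac (x : T) : signed_measure T R :=
  sm_of_charge (charge_of_finite_measure (@dirac _ T x R)).

Lemma sm_diracE x E : measurable E -> sm_dirac x E = (\d_x E : \bar R).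
Proof. exact: sm_of_chargeE. Qed.

Definition ev (E : set T) mu : R := fine (mu E).

End signed_measure_theory.

Section direct_image.
Context d1 d2 (T1 : measurableType d1) (T2 : measurableType d2) (R : realType).
Variables (f : T1 -> T2) (mf : measurable_fun setT f).

Definition direct_image (mu : signed_measure T1 R) : signed_measure T2 R :=
  sm_of_charge
    (@measure_function_pushforward__canonical__charge_Charge
       _ _ T1 T2 f R mu mf).

Lemma direct_imageE mu E : measurable E -> direct_image mu E = mu (f @^-1` E).
Proof. exact: sm_of_chargeE. Qed.

End direct_image.

(* The set [A] with the trace sigma-algebra; the library requires the carrier
   of a [measurableType] to be pointed, whence the argument [a]. *)
Definition trace_type d (T : measurableType d) (A : set T) (a : A) : Type :=
  set_type A.

Section trace_type.
Context d (T : measurableType d) (A : set T) (a : A).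

HB.instance Definition _ := Choice.on (trace_type a).
HB.instance Definition _ := isPointed.Build (trace_type a) a.

Definition inclusion (x : trace_type a) : T := val x.

Definition trace_measurable : set (set (trace_type a)) :=
  [set inclusion @^-1` E | E in measurable].

Lemma trace_measurable0 : trace_measurable set0.
Proof. by exists set0 => //; rewrite preimage_set0. Qed.

Lemma trace_measurableC F : trace_measurable F -> trace_measurable (~` F).
Proof.
by move=> [E mE <-]; exists (~` E); [exact: measurableC|rewrite preimage_setC].
Qed.

Lemma trace_measurable_bigcup (F : (set (trace_type a))^nat) :
  (forall i, trace_measurable (F i)) -> trace_measurable (\bigcup_i F i).
Proof.
move=> /(_ _)/cid2 mF; exists (\bigcup_i sval (mF i)).
  by apply: bigcup_measurable => i _; case: (mF i).
by rewrite preimage_bigcup; apply: eq_bigcupr => i _; case: (mF i).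
Qed.

HB.instance Definition _ := @isMeasurable.Build (preimage_display inclusion)
  (trace_type a) trace_measurable trace_measurable0 trace_measurableC
  trace_measurable_bigcup.

Lemma measurable_inclusion : measurable_fun setT inclusion.
Proof. by move=> _ E mE; rewrite setTI; exists E. Qed.

End trace_type.

Section supported_by.
Context d (T : measurableType d) (R : realType).
Implicit Types (mu nu : signed_measure T R) (A B : set T).

(* Since [trace_type] is pointed, [A = set0] is treated apart: 0 is the only
   signed measure on the empty space. *)
Definition supported_by mu A :=
  (A = set0 /\ mu = 0) \/
  exists (a : A) (nu : signed_measure (trace_type a) R),
    mu = direct_image (@measurable_inclusion d T A a) nu.

Section trace_charge.
Variables (mu : signed_measure T R) (A : set T) (a : A).
Hypothesis muA : forall E, measurable E -> E `&` A = set0 -> mu E = 0%E.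

Let lift (F : set (trace_type a)) : set T :=
  if pselect (trace_measurable F) is left mF then sval (cid2 mF) else set0.

Let lift_measurable F : measurable (lift F).
Proof. by rewrite /lift; case: pselect => // mF; case: (cid2 mF). Qed.

Let liftK F : measurable F -> @inclusion _ _ _ a @^-1` lift F = F.
Proof.
by rewrite /lift; case: pselect => // mF _; case: (cid2 mF).
Qed.

Let muE E1 E2 : measurable E1 -> measurable E2 ->
  @inclusion _ _ _ a @^-1` E1 = @inclusion _ _ _ a @^-1` E2 -> mu E1 = mu E2.
Proof.
move=> mE1 mE2 E12.
have E x : A x -> E1 x = E2 x.
  by move=> Ax; exact: (congr1 (fun S => S (SigSub (mem_set Ax))) E12).
rewrite (chargeDI mu mE1 mE2) [RHS](chargeDI mu mE2 mE1) setIC; congr (_ + _)%E.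
rewrite !muA//; try exact: measurableD.
- by apply/seteqP; split => x //= -[[? +] /E e]; rewrite e.
- by apply/seteqP; split => x //= -[[? +] /E e]; rewrite -e.
Qed.

Definition trace_charge (F : set (trace_type a)) : \bar R := mu (lift F).

Let trace_charge0 : trace_charge set0 = 0%E.
Proof.
rewrite -[RHS](charge0 mu); apply: muE => //.
by rewrite liftK// preimage_set0.
Qed.

Let trace_charge_fin F : measurable F -> trace_charge F \is a fin_num.
Proof. by move=> _; exact/sm_fin/lift_measurable. Qed.

Let trace_charge_semi_sigma_additive : semi_sigma_additive trace_charge.
Proof.
move=> F mF tF mUF.
pose G := seqDU (fun i => lift (F i)).
have mG i : measurable (G i).
  rewrite /G /seqDU; apply: measurableD; first exact: lift_measurable.
  by apply: bigsetU_measurable => *; exact: lift_measurable.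
have GF i : @inclusion _ _ _ a @^-1` G i = F i.
  rewrite /G /seqDU -[RHS](liftK (mF i)); apply/seteqP; split => x; first by case.
  move=> Lx; split => //.
  rewrite /= -(bigcup_mkord _ (fun j => lift (F j))) => -[j /= ji Ljx].
  move/trivIsetP : tF => /(_ j i I I); rewrite neq_ltn ji => /(_ isT).
  move=> /(congr1 (@^~ x))/=; rewrite -(liftK (mF i)) -(liftK (mF j)) => <-.
  by split.
rewrite [X in X @ _ --> _](_ : _ = (fun n => \sum_(0 <= i < n) mu (G i))%E).
  rewrite (_ : trace_charge _ = mu (\bigcup_i G i)).
    apply: charge_semi_sigma_additive => //; first exact: trivIset_seqDU.
    exact: bigcup_measurable.
  apply: muE => //; first exact: bigcup_measurable.
  by rewrite liftK// preimage_bigcup; apply: eq_bigcupr => i _; rewrite GF.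
apply/funext => n; apply: eq_bigr => i _; apply: muE => //.
by rewrite liftK// GF.
Qed.

HB.instance Definition _ := isCharge.Build _ _ _ trace_charge
  trace_charge0 trace_charge_fin trace_charge_semi_sigma_additive.

Lemma trace_chargeE :
  mu = direct_image (@measurable_inclusion d T A a) (sm_of_charge trace_charge).
Proof.
apply: sm_ext => E mE; rewrite direct_imageE// sm_of_chargeE; last by exists E.
by apply: muE => //; rewrite liftK//; exists E.
Qed.

End trace_charge.

Lemma supported_byP mu A : supported_by mu A <->
  forall E, measurable E -> E `&` A = set0 -> mu E = 0%E.
Proof.
split=> [[[_ ->] E _ _|[a [nu ->]] E mE EA]|muA]; first exact: sm0.
  rewrite direct_imageE// (_ : _ @^-1` _ = set0) ?charge0//.
  apply/seteqP; split => // x Ex.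
  have : (E `&` A) (inclusion x) by split; [exact: Ex|exact: set_valP].
  by rewrite EA.
have [A0|/set0P[x Ax]] := eqVneq A set0.
  left; split => //; apply: sm_ext => E mE.
  by rewrite sm0 muA// A0 setI0.
right; exists (SigSub (mem_set Ax)); eexists; exact: trace_chargeE.
Qed.

Lemma supported_by_subset mu A B : A `<=` B -> supported_by mu A -> supported_by mu B.
Proof.
move=> AB /supported_byP muA; apply/supported_byP => E mE EB.
apply: muA => //; apply/seteqP; split => // x [Ex /AB Bx].
have : (E `&` B) x by split.
by rewrite EB.
Qed.

Lemma supported_by0 A : supported_by 0 A.
Proof. by apply/supported_byP => E _ _; exact: sm0. Qed.

Lemma supported_byD mu nu A B :
  supported_by mu A -> supported_by nu B -> supported_by (mu + nu) (A `|` B).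
Proof.
move=> /(supported_by_subset (@subsetUl _ A B))/supported_byP muA.
move=> /(supported_by_subset (@subsetUr _ A B))/supported_byP nuB.
by apply/supported_byP => E mE EAB; rewrite smD muA// nuB// adde0.
Qed.

Lemma supported_byZ a mu A : supported_by mu A -> supported_by (a *: mu) A.
Proof.
move=> /supported_byP muA.
by apply/supported_byP => E mE EA; rewrite smZ muA// mule0.
Qed.

Lemma supported_by_dirac x : supported_by (sm_dirac R x) [set x].
Proof.
apply/supported_byP => E mE Ex; rewrite sm_diracE// diracE memNset// => xE.
have : (E `&` [set x]) x by split.
by rewrite Ex.
Qed.

End supported_by.

Lemma supported_by_image d1 d2 (T1 : measurableType d1) (T2 : measurableType d2)
    (R : realType) (f : T1 -> T2) (mf : measurable_fun setT f)
    (mu : signed_measure T1 R) A :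
  supported_by mu A -> supported_by (direct_image mf mu) (f @` A).
Proof.
move=> /supported_byP muA; apply/supported_byP => E mE EA.
rewrite direct_imageE// muA//; first by rewrite -[X in measurable X]setTI; exact: mf.
apply/seteqP; split => // x [Ex Ax].
have : (E `&` f @` A) (f x) by split => //; exists x.
by rewrite EA.
Qed.

Record bornology (T : Type) := Bornology {
  bdd :> set T -> Prop ;
  bdd0 : bdd set0 ;
  bdd_subset : forall A B, A `<=` B -> bdd B -> bdd A ;
  bddU : forall A B, bdd A -> bdd B -> bdd (A `|` B) ;
  bdd1 : forall x, bdd [set x] }.

Definition bornological (S T : Type) (BS : bornology S) (BT : bornology T)
  (f : S -> T) := forall A, BS A -> BT (f @` A).

Section prod_bornology.
Context (S T : Type) (BS : bornology S) (BT : bornology T).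

Definition prod_bdd : set (set (S * T)) :=
  [set A | BS (fst @` A) /\ BT (snd @` A)].

Lemma prod_bdd0 : prod_bdd set0.
Proof. by split; rewrite image_set0; exact: bdd0. Qed.

Lemma prod_bdd_subset A B : A `<=` B -> prod_bdd B -> prod_bdd A.
Proof.
by move=> AB [B1 B2]; split; [apply: bdd_subset B1|apply: bdd_subset B2];
  exact: image_subset.
Qed.

Lemma prod_bddU A B : prod_bdd A -> prod_bdd B -> prod_bdd (A `|` B).
Proof.
by move=> [A1 A2] [B1 B2]; split; rewrite image_setU; exact: bddU.
Qed.

Lemma prod_bdd1 x : prod_bdd [set x].
Proof. by split; rewrite image_set1; exact: bdd1. Qed.

Definition prod_bornology : bornology (S * T) :=
  Bornology prod_bdd0 prod_bdd_subset prod_bddU prod_bdd1.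

End prod_bornology.

Section real_bornology.
Context (R : realType).

Definition real_bdd : set (set R) := [set A : set R^o | bounded_set A].

Lemma real_bdd0 : real_bdd set0.
Proof. by exists 0; split => // M _ x. Qed.

Lemma real_bdd_subset A B : A `<=` B -> real_bdd B -> real_bdd A.
Proof. by move=> AB [M [Mr MB]]; exists M; split => // N /MB NB x /AB /NB. Qed.

Lemma real_bddU A B : real_bdd A -> real_bdd B -> real_bdd (A `|` B).
Proof.
rewrite /real_bdd/= /bounded_near => bA bB; near=> M => x [Ax|Bx].
- by move: x Ax; near: M.
- by move: x Bx; near: M.
Unshelve. all: by end_near. Qed.

Lemma real_bdd1 x : real_bdd [set x].
Proof.
rewrite /real_bdd/= /bounded_near; near=> M => _ /= ->.
by near: M; exact: nbhs_pinfty_ge.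
Unshelve. all: by end_near. Qed.

Definition real_bornology : bornology R :=
  Bornology real_bdd0 real_bdd_subset real_bddU real_bdd1.

End real_bornology.

(* No compatibility between the sigma-algebra and the bornology is required.
   A [measurableType] is nonempty and comes with a distinguished point, which
   plays no role below (morphisms need not preserve it).  Every algebra of the
   monad is nonempty, as it contains the image of the zero measure. *)
Record bornMeas := BornMeas {
  bm_disp : measure_display ;
  bm_sort :> measurableType bm_disp ;
  bm_born : bornology bm_sort }.

Record bm_hom (X Y : bornMeas) := BmHom {
  bm_fun :> X -> Y ;
  bm_measurable : measurable_fun setT bm_fun ;
  bm_bornological : bornological (bm_born X) (bm_born Y) bm_fun }.

Lemma bm_hom_ext (X Y : bornMeas) (f g : bm_hom X Y) :
  (bm_fun f = bm_fun g) -> f = g.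
Proof.
case: f g => [f mf bf] [g mg bg] /= fg; subst g.
by rewrite (Prop_irrelevance mf mg) (Prop_irrelevance bf bg).
Qed.

Definition bm_id (X : bornMeas) : bm_hom X X.
Proof.
exists id; first exact: measurable_id.
by move=> A bA; rewrite image_id.
Defined.

Definition bm_comp (X Y Z : bornMeas) (g : bm_hom Y Z) (f : bm_hom X Y) :
  bm_hom X Z.
Proof.
exists (g \o f).
  exact: measurableT_comp (bm_measurable g) (bm_measurable f).
move=> A bA; rewrite -image_comp.
exact/(bm_bornological g)/(bm_bornological f).
Defined.

Section M_object.
Context (R : realType) (X : bornMeas).

Definition boundedly_supported : {pred signed_measure X R} :=
  [pred mu | `[< exists2 B, bm_born X B & supported_by mu B >]].

Lemma boundedly_supported_submod : submod_closed boundedly_supported.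
Proof.
split; first by apply/asboolP; exists set0; [exact: bdd0|exact: supported_by0].
move=> a mu nu /asboolP[A bA muA] /asboolP[B bB nuB]; apply/asboolP.
exists (A `|` B); first exact: bddU.
by apply: supported_byD => //; exact: supported_byZ.
Qed.

HB.instance Definition _ := GRing.isSubmodClosed.Build R
  (signed_measure X R) boundedly_supported boundedly_supported_submod.

Record M_set := MSet {
  M_val : signed_measure X R ;
  M_valP : M_val \in boundedly_supported }.

HB.instance Definition _ := [isSub for M_val].
HB.instance Definition _ := [Choice of M_set by <:].
HB.instance Definition _ := [SubChoice_isSubLmodule of M_set by <:].
HB.instance Definition _ := isPointed.Build M_set 0.

Definition M_ev (E : set X) (mu : M_set) : R := ev E (M_val mu).

Definition M_generators : set (set M_set) :=
  \bigcup_(E in measurable) preimage_set_system setT (M_ev E) measurable.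

HB.instance Definition _ := @isMeasurable.Build (sigma_display M_generators)
  M_set <<s M_generators >> (@sigma_algebra0 _ setT M_generators)
  (@sigma_algebraC _ M_generators) (@sigma_algebra_bigcup _ setT M_generators).

Lemma measurable_M_ev E : measurable_fun setT (M_ev E).
Proof.
have [mE|mE] := pselect (measurable E).
  move=> _ F mF; apply: sub_sigma_algebra; exists E => //; exists F => //.
rewrite (_ : M_ev E = cst 0)//.
by apply/funext => mu; rewrite /M_ev /ev sm_out.
Qed.

Definition M_ball (B : set X) (gamma : R) : set M_set :=
  [set mu | supported_by (M_val mu) B /\ sm_norm (M_val mu) <= gamma].

Definition M_bdd : set (set M_set) :=
  [set S | exists B gamma,
    [/\ bm_born X B, 0 <= gamma & S `<=` M_ball B gamma]].

Lemma M_bdd0 : M_bdd set0.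
Proof. by exists set0, 0; split => //; exact: bdd0. Qed.

Lemma M_bdd_subset S1 S2 : S1 `<=` S2 -> M_bdd S2 -> M_bdd S1.
Proof.
by move=> S12 [B [g [bB g0 S2B]]]; exists B, g; split => // mu /S12 /S2B.
Qed.

Lemma M_bddU S1 S2 : M_bdd S1 -> M_bdd S2 -> M_bdd (S1 `|` S2).
Proof.
move=> [B1 [g1 [bB1 g10 S1B]]] [B2 [g2 [bB2 g20 S2B]]].
exists (B1 `|` B2), (g1 + g2); split; [exact: bddU|exact: addr_ge0|].
move=> mu [/S1B|/S2B] [muB mug]; split.
- exact: supported_by_subset muB.
- by rewrite (le_trans mug)// lerDl.
- exact: supported_by_subset muB.
- by rewrite (le_trans mug)// lerDr.
Qed.

Lemma M_bdd1 mu : M_bdd [set mu].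
Proof.
have /asboolP[B bB muB] := M_valP mu.
exists B, (sm_norm (M_val mu)); split => //; last by move=> _ ->; split.
exact/fine_ge0/(measure_ge0 (charge_variation _)).
Qed.

Definition M_bornology : bornology M_set :=
  Bornology M_bdd0 M_bdd_subset M_bddU M_bdd1.

Definition M : bornMeas := BornMeas M_bornology.

Lemma M_ext (mu nu : M) :
  (forall E, measurable E -> M_val mu E = M_val nu E) -> mu = nu.
Proof. by move=> /sm_ext/val_inj. Qed.

Lemma delta_subproof (x : X) : sm_dirac R x \in boundedly_supported.
Proof.
apply/asboolP; exists [set x]; [exact: bdd1|exact: supported_by_dirac].
Qed.

Definition delta (x : X) : M := MSet (delta_subproof x).

End M_object.

Section M_map.
Context (R : realType) (X Y : bornMeas) (f : bm_hom X Y).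

Lemma M_map_subproof (mu : M R X) :
  direct_image (bm_measurable f) (M_val mu) \in boundedly_supported (R := R) (X := Y).
Proof.
have /asboolP[B bB muB] := M_valP mu.
apply/asboolP; exists (f @` B); first exact: bm_bornological.
exact: supported_by_image.
Qed.

Definition M_map (mu : M R X) : M R Y := MSet (M_map_subproof mu).

End M_map.

Section sm_integral_theory.
Context d (T : measurableType d) (R : realType).
Implicit Types (mu : signed_measure T R).

Lemma sm_pos_null mu A E : supported_by mu A -> measurable E ->
  E `&` A = set0 -> sm_pos mu E = 0%E.
Proof.
move=> /supported_byP muA mE EA.
have [[mP _] _ _ _] := svalP (hahn_sets mu).
rewrite /sm_pos jordan_posE cjordan_posE /crestr0 mem_set// /crestr muA//.
  exact: measurableI.
by rewrite setIAC EA set0I.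
Qed.

Lemma sm_neg_null mu A E : supported_by mu A -> measurable E ->
  E `&` A = set0 -> sm_neg mu E = 0%E.
Proof.
move=> /supported_byP muA mE EA.
have [_ [mN _] _ _] := svalP (hahn_sets mu).
rewrite /sm_neg jordan_negE cjordan_negE /crestr0 mem_set// /crestr muA//.
- by rewrite oppe0.
- exact: measurableI.
by rewrite setIAC EA set0I.
Qed.

Lemma sm_posB_neg mu E : measurable E -> mu E = (sm_pos mu E - sm_neg mu E)%E.
Proof.
move=> mE; rewrite (jordan_decomp (svalP (hahn_sets mu)) mE).
by rewrite /cadd/= cscaleN1.
Qed.

Lemma le_sm_norm mu E : measurable E -> `|ev E mu| <= sm_norm mu.
Proof.
move=> mE; rewrite -lee_fin.
have -> : `|ev E mu|%:E = `|mu E|%E by rewrite -[in RHS](fineK (sm_fin mu mE)).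
apply: le_trans (abse_charge_variation (svalP (hahn_sets mu)) mE) _.
rewrite /sm_norm fineK; last exact: fin_num_measure.
by apply: le_measure; rewrite ?inE.
Qed.

Lemma sm_integral_decomp mu (m1 m2 : {measure set T -> \bar R})
    (f : T -> R) :
  (forall E, measurable E -> m1 E \is a fin_num) ->
  (forall E, measurable E -> m2 E \is a fin_num) ->
  (forall E, measurable E -> mu E = (m1 E - m2 E)%E) ->
  (sm_pos mu).-integrable setT (EFin \o f) ->
  (sm_neg mu).-integrable setT (EFin \o f) ->
  m1.-integrable setT (EFin \o f) ->
  m2.-integrable setT (EFin \o f) ->
  sm_integral mu f = \int[m1]_x f x - \int[m2]_x f x.
Proof.
move=> fin1 fin2 mu12 ip im i1 i2.
have e : (\int[measure_add (sm_pos mu) m2]_x (f x)%:E =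
          \int[measure_add (sm_neg mu) m1]_x (f x)%:E)%E.
  apply: eq_measure_integral => E mE _.
  transitivity (sm_pos mu E + m2 E)%E; first exact: measure_addE.
  transitivity (sm_neg mu E + m1 E)%E; last exact/esym/measure_addE.
  have := mu12 E mE; rewrite sm_posB_neg//.
  have : sm_pos mu E \is a fin_num by rewrite fin_num_measure.
  have : sm_neg mu E \is a fin_num by rewrite fin_num_measure.
  have : m1 E \is a fin_num by exact: fin1.
  have : m2 E \is a fin_num by exact: fin2.
  case: (sm_pos mu E) => // p; case: (sm_neg mu E) => // n.
  case: (m1 E) => // a; case: (m2 E) => // b _ _ _ _ [h].
  by rewrite -!EFinD; congr EFin; lra.
move: e; rewrite !integral_measure_add//.
have := integrable_fin_num measurableT ip.
have := integrable_fin_num measurableT im.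
have := integrable_fin_num measurableT i1.
have := integrable_fin_num measurableT i2.
rewrite /sm_integral /Rintegral/=.
move: (integral _ _ _) (integral _ _ _) (integral _ _ _) (integral _ _ _).
by move=> [b| |] [a| |] [n| |] [p| |]//= _ _ _ _ [h]; lra.
Qed.

End sm_integral_theory.

Section bounded_ev.
Context (R : realType) (X : bornMeas) (B : set X) (gamma : R).
Context (m : {finite_measure set (M_set R X) -> \bar R}).
Hypothesis mB : forall E, measurable E -> E `&` M_ball B gamma = set0 -> m E = 0%E.

Let ev_le E : measurable E ->
  \forall mu \ae m, (`|(M_ev E mu)%:E| <= gamma%:E)%E.
Proof.
move=> mE.
have mgt : measurable [set mu | gamma < `|M_ev E mu|].
  have /(_ measurableT) : measurable_fun setT (fun mu : M_set R X => `|M_ev E mu|).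
    by apply: measurableT_comp => //; exact: measurable_M_ev.
  move=> /(_ `]gamma, +oo[%classic (measurable_itv _)).
  rewrite setTI; congr (measurable _).
  by apply/seteqP; split => mu /=; rewrite in_itv/= andbT.
exists [set mu | gamma < `|M_ev E mu|]; split.
- exact: mgt.
- apply: mB.
    exact: mgt.
  apply/seteqP; split => // mu [/= gmu [_ mug]].
  by move: gmu; rewrite ltNge (le_trans (le_sm_norm _ mE) mug).
- by move=> mu /=; rewrite lee_fin ltNge => /negP.
Qed.

Let mev E : measurable_fun setT (EFin \o @M_ev R X E).
Proof. by apply/measurable_EFinP; exact: measurable_M_ev. Qed.

Lemma integrable_M_ev E : measurable E ->
  m.-integrable setT (EFin \o M_ev E).
Proof.
move=> mE.
have [] // := @dominated_convergence _ _ _ m setT measurableT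
  (fun _ => EFin \o @M_ev R X E) (EFin \o @M_ev R X E) (EFin \o cst gamma) _ _ _ _ _.
- by apply: aeW => mu _; exact: cvg_cst.
- exact: finite_measure_integrable_cst.
- by apply: ae_foralln => _; apply: filterS (ev_le mE) => mu.
Qed.

Lemma integral_M_ev_sigma_additive :
  semi_sigma_additive (fun E => \int[m]_mu (M_ev E mu)%:E)%E.
Proof.
move=> F mF tF mUF.
have evE (mu : M_set R X) E : measurable E -> (M_ev E mu)%:E = M_val mu E.
  by move=> mE; rewrite /M_ev /ev fineK// sm_fin.
have mUn n : measurable (\big[setU/set0]_(i < n) F i).
  exact: bigsetU_measurable.
have evU n : (EFin \o @M_ev R X (\big[setU/set0]_(i < n) F i)) =
    (fun mu => \sum_(0 <= i < n) (M_ev (F i) mu)%:E)%E.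
  apply/funext => mu; rewrite big_mkord.
  apply: etrans (evE mu _ (mUn n)) _.
  apply: etrans (charge_semi_additive F n mF tF (mUn n)) _.
  by apply: eq_bigr => i _; rewrite evE.
rewrite [X in X @ _ --> _](_ : _ =
    (fun n => \int[m]_mu (M_ev (\big[setU/set0]_(i < n) F i) mu)%:E)%E); last first.
  apply/funext => n; rewrite -(integral_sum measurableT).
    by apply: eq_integral => mu _; rewrite -[RHS]/((EFin \o _) mu) evU.
  by move=> i; exact: integrable_M_ev.
have [] // := @dominated_convergence _ _ _ m setT measurableT
  (fun n => EFin \o @M_ev R X (\big[setU/set0]_(i < n) F i))
  (EFin \o @M_ev R X (\bigcup_i F i)) (EFin \o cst gamma) _ _ _ _ _.
- apply: aeW => mu _ /=; rewrite evE//.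
  rewrite [X in X @ _ --> _](_ : _ = (fun n => \sum_(0 <= i < n) M_val mu (F i))%E).
    exact: charge_semi_sigma_additive.
  apply/funext => n; rewrite -[LHS]/((EFin \o _) mu) evU.
  by apply: eq_bigr => i _; rewrite evE.
- exact: finite_measure_integrable_cst.
- by apply: ae_foralln => n; apply: filterS (ev_le (mUn n)) => mu.
Qed.

Lemma integral_M_ev_null E : measurable E -> E `&` B = set0 ->
  (\int[m]_mu (M_ev E mu)%:E = 0)%E.
Proof.
move=> mE EB; rewrite -[RHS](integral0 m setT).
apply: ae_eq_integral => //; first exact: mev.
have mne0 : measurable [set mu : M_set R X | M_ev E mu != 0].
  have /(_ measurableT) := @measurable_M_ev R X E.
  move=> /(_ (~` [set 0]) (measurableC (measurable_set1 _))).
  rewrite setTI; congr (measurable _).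
  by apply/seteqP; split => mu /= /eqP.
exists [set mu | M_ev E mu != 0]; split => //.
- apply: mB => //; apply/seteqP; split => // mu [/= /eqP + [/supported_byP muB _]].
  by apply; rewrite /M_ev /ev muB.
- by move=> mu /= h; apply/eqP => mu0; apply: h => _; rewrite mu0.
Qed.

End bounded_ev.

Lemma subeD_fin (R : realType) (a b c e : \bar R) :
  a \is a fin_num -> b \is a fin_num -> c \is a fin_num -> e \is a fin_num ->
  (a - b + (c - e) = (a + c) - (b + e))%E.
Proof.
case: a b c e => [a| |] [b| |] [c| |] [e| |]//= _ _ _ _.
by congr EFin; lra.
Qed.

Section M_M_theory.
Context (R : realType) (X : bornMeas).
Implicit Types (MM : M R (M R X)).

Lemma M_M_supportP MM : exists B gamma,
  bm_born X B /\ supported_by (M_val MM) (M_ball B gamma).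
Proof.
have /asboolP[S [B [gamma [bB _ SB]]] MMS] := M_valP MM.
by exists B, gamma; split => //; exact: supported_by_subset MMS.
Qed.

Lemma integrable_pos_M_ev MM E : measurable E ->
  (sm_pos (M_val MM)).-integrable setT (EFin \o @M_ev R X E).
Proof.
move=> mE; have [B [g [bB MMB]]] := M_M_supportP MM.
apply: (integrable_M_ev (B := B) (gamma := g)) => // F mF.
exact: sm_pos_null MMB mF.
Qed.

Lemma integrable_neg_M_ev MM E : measurable E ->
  (sm_neg (M_val MM)).-integrable setT (EFin \o @M_ev R X E).
Proof.
move=> mE; have [B [g [bB MMB]]] := M_M_supportP MM.
apply: (integrable_M_ev (B := B) (gamma := g)) => // F mF.
exact: sm_neg_null MMB mF.
Qed.

End M_M_theory.

Section kappa.
Context (R : realType) (X : bornMeas) (MM : M R (M R X)).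

Definition kappa_charge (E : set X) : \bar R :=
  (sm_integral (M_val MM) (M_ev E))%:E.

Let kappa_chargeE E : measurable E ->
  kappa_charge E = (\int[sm_pos (M_val MM)]_mu (M_ev E mu)%:E -
                    \int[sm_neg (M_val MM)]_mu (M_ev E mu)%:E)%E.
Proof.
move=> mE; rewrite /kappa_charge /sm_integral /Rintegral EFinB.
rewrite !fineK//.
- exact: integrable_fin_num (integrable_neg_M_ev MM mE).
- exact: integrable_fin_num (integrable_pos_M_ev MM mE).
Qed.

Let kappa_charge0 : kappa_charge set0 = 0%E.
Proof.
rewrite kappa_chargeE//.
under eq_integral do rewrite /M_ev /ev charge0.
under [X in (_ - X)%E]eq_integral do rewrite /M_ev /ev charge0.
by rewrite !integral0 sube0.
Qed.

Let kappa_charge_fin E : measurable E -> kappa_charge E \is a fin_num.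
Proof. by []. Qed.

Let kappa_charge_semi_sigma_additive : semi_sigma_additive kappa_charge.
Proof.
have [B [g [bB MMB]]] := M_M_supportP MM.
move=> F mF tF mUF; rewrite kappa_chargeE//.
rewrite [X in X @ _ --> _](_ : _ = (fun n =>
    \sum_(0 <= i < n) \int[sm_pos (M_val MM)]_mu (M_ev (F i) mu)%:E -
    \sum_(0 <= i < n) \int[sm_neg (M_val MM)]_mu (M_ev (F i) mu)%:E)%E).
  apply: cvgeB.
  - rewrite fin_num_adde_defr//.
    exact: integrable_fin_num (integrable_pos_M_ev MM mUF).
  - apply: (integral_M_ev_sigma_additive (B := B) (gamma := g)) => //.
    by move=> G mG; exact: sm_pos_null MMB mG.
  - apply: (integral_M_ev_sigma_additive (B := B) (gamma := g)) => //.
      by move=> G mG; exact: sm_neg_null MMB mG.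
apply/funext => n; elim: n => [|n IH]; first by rewrite !big_nil sube0.
rewrite !big_nat_recr//= IH kappa_chargeE//.
have p i := integrable_fin_num measurableT (integrable_pos_M_ev MM (mF i)).
have q i := integrable_fin_num measurableT (integrable_neg_M_ev MM (mF i)).
have sp : (\sum_(0 <= i < n) \int[sm_pos (M_val MM)]_mu (M_ev (F i) mu)%:E)%E
    \is a fin_num by apply/sum_fin_numP => i _ _; exact: p.
have sq : (\sum_(0 <= i < n) \int[sm_neg (M_val MM)]_mu (M_ev (F i) mu)%:E)%E
    \is a fin_num by apply/sum_fin_numP => i _ _; exact: q.
apply: etrans (subeD_fin _ _ _ _) _; [exact: sp|exact: sq|exact: p|exact: q|by []].
Qed.

HB.instance Definition _ := isCharge.Build _ _ _ kappa_charge
  kappa_charge0 kappa_charge_fin kappa_charge_semi_sigma_additive.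

Lemma kappa_subproof : sm_of_charge kappa_charge \in boundedly_supported (X := X).
Proof.
have [B [g [bB MMB]]] := M_M_supportP MM.
apply/asboolP; exists B => //; apply/supported_byP => E mE EB.
apply: etrans (sm_of_chargeE _ mE) _; apply: etrans (kappa_chargeE mE) _.
rewrite !(integral_M_ev_null (B := B) (gamma := g))//.
- by rewrite sube0.
- by move=> G mG; exact: sm_neg_null MMB mG.
- by move=> G mG; exact: sm_pos_null MMB mG.
Qed.

Definition kappa : M R X := MSet kappa_subproof.

Lemma kappaE E : measurable E ->
  M_val kappa E = (sm_integral (M_val MM) (M_ev E))%:E.
Proof. exact: sm_of_chargeE. Qed.

End kappa.

Lemma muleBN_fin (R : realType) (a : R) (p n : \bar R) :
  p \is a fin_num -> n \is a fin_num ->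
  (a%:E * (p - n) = (- a)%:E * n - (- a)%:E * p)%E.
Proof.
case: p n => [p| |] [n| |]//= _ _.
by rewrite -EFinB -!EFinM -EFinB; congr EFin; ring.
Qed.

Section kappa_linear.
Context (R : realType).

Lemma integrable_measure_add d (T : measurableType d)
    (m1 m2 : {measure set T -> \bar R}) (f : T -> \bar R) :
  m1.-integrable setT f -> m2.-integrable setT f ->
  (measure_add m1 m2).-integrable setT f.
Proof.
move=> /integrableP[mf i1] /integrableP[_ i2]; apply/integrableP; split => //.
rewrite ge0_integral_measure_add//; first exact: lte_add_pinfty.
exact: measurableT_comp.
Qed.

Lemma measure_add_fin d (T : measurableType d)
    (m1 m2 : {measure set T -> \bar R}) E :
  m1 E \is a fin_num -> m2 E \is a fin_num ->
  measure_add m1 m2 E \is a fin_num.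
Proof. by move=> f1 f2; rewrite measure_addE fin_numD f1. Qed.

Lemma integrable_mscale d (T : measurableType d) (k : {nonneg R})
    (m : {measure set T -> \bar R}) (f : T -> \bar R) :
  m.-integrable setT f -> (mscale k m).-integrable setT f.
Proof.
move=> /integrableP[mf i1]; apply/integrableP; split => //.
rewrite ge0_integral_mscale//; last exact: measurableT_comp.
by rewrite lte_mul_pinfty.
Qed.

Lemma Rintegral_mscale d (T : measurableType d) (k : {nonneg R})
    (m : {measure set T -> \bar R}) (f : T -> R) :
  m.-integrable setT (EFin \o f) ->
  \int[mscale k m]_x f x = k%:num * \int[m]_x f x.
Proof.
move=> fi; have /integrableP[mf _] := fi.
have pf : (\int[m]_x ((EFin \o f)^\+ x))%E \is a fin_num.
  by apply: integrable_fin_num => //; exact: integrable_funepos.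
have nf : (\int[m]_x ((EFin \o f)^\- x))%E \is a fin_num.
  by apply: integrable_fin_num => //; exact: integrable_funeneg.
rewrite /Rintegral; set u := integral _ _ _; set v := integral _ _ _.
suff -> : u = (k%:num%:E * v)%E.
  by rewrite fineM//; exact: integrable_fin_num.
have mp := measurable_funepos mf; have mn := measurable_funeneg mf.
rewrite /u /v integralE [in RHS]integralE !ge0_integral_mscale//.
by apply/esym/muleBr => //; exact: fin_num_adde_defr.
Qed.

Lemma Rintegral_measure_add d (T : measurableType d)
    (m1 m2 : {measure set T -> \bar R}) (f : T -> R) :
  m1.-integrable setT (EFin \o f) -> m2.-integrable setT (EFin \o f) ->
  \int[measure_add m1 m2]_x f x = \int[m1]_x f x + \int[m2]_x f x.
Proof.
move=> i1 i2; rewrite /Rintegral integral_measure_add// fineD//;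
  exact: integrable_fin_num.
Qed.

Context (X : bornMeas).
Implicit Types (AA BB : M R (M R X)) (u v : M R X).

Lemma kappaD AA BB : kappa (AA + BB : M_set R (M R X)) = (kappa AA + kappa BB : M_set R X).
Proof.
apply: M_ext => E mE; apply: etrans (kappaE _ mE) _.
apply: etrans; last by apply/esym; exact: smD.
rewrite !kappaE// -EFinD; congr EFin.
pose m1 := measure_add (sm_pos (M_val AA)) (sm_pos (M_val BB)).
pose m2 := measure_add (sm_neg (M_val AA)) (sm_neg (M_val BB)).
have ipA := integrable_pos_M_ev AA mE.
have inA := integrable_neg_M_ev AA mE.
have ipB := integrable_pos_M_ev BB mE.
have inB := integrable_neg_M_ev BB mE.
rewrite (@sm_integral_decomp _ _ _ _ m1 m2).
- by rewrite !Rintegral_measure_add// /sm_integral opprD addrACA.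
- by move=> F mF; apply: measure_add_fin; exact: fin_num_measure.
- by move=> F mF; apply: measure_add_fin; exact: fin_num_measure.
- move=> F mF; apply: etrans (smD _ _ _) _.
  rewrite !sm_posB_neg//; apply: etrans (subeD_fin _ _ _ _) _;
    [exact: fin_num_measure..|].
  by congr (_ - _)%E; apply/esym; exact: measure_addE.
- exact: (integrable_pos_M_ev (AA + BB : M_set R (M R X))).
- exact: (integrable_neg_M_ev (AA + BB : M_set R (M R X))).
- exact: integrable_measure_add.
- exact: integrable_measure_add.
Qed.

Lemma kappaZ a AA : kappa (a *: AA : M_set R (M R X)) = (a *: kappa AA : M_set R X).
Proof.
apply: M_ext => E mE; apply: etrans (kappaE _ mE) _.
apply: etrans; last by apply/esym; exact: smZ.
rewrite !kappaE// -EFinM; congr EFin.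
have ip := integrable_pos_M_ev AA mE.
have im := integrable_neg_M_ev AA mE.
have fp F : measurable F -> sm_pos (M_val AA) F \is a fin_num by exact: fin_num_measure.
have fn F : measurable F -> sm_neg (M_val AA) F \is a fin_num by exact: fin_num_measure.
have [a0|a0] := leP 0 a.
  pose k := NngNum a0.
  rewrite (@sm_integral_decomp _ _ _ _ (mscale k (sm_pos (M_val AA)))
    (mscale k (sm_neg (M_val AA)))).
  - by rewrite !Rintegral_mscale// /sm_integral mulrBr.
  - by move=> F mF; rewrite /mscale/= fin_numM// fp.
  - by move=> F mF; rewrite /mscale/= fin_numM// fn.
  - move=> F mF; apply: etrans (smZ _ _ _) _; rewrite sm_posB_neg//.
    by apply: muleBr => //; apply: fin_num_adde_defr; exact: fp.
  - exact: (integrable_pos_M_ev (a *: AA : M_set R (M R X))).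
  - exact: (integrable_neg_M_ev (a *: AA : M_set R (M R X))).
  - exact: integrable_mscale.
  - exact: integrable_mscale.
have a1 : 0 <= - a by rewrite oppr_ge0 ltW.
pose k := NngNum a1.
rewrite (@sm_integral_decomp _ _ _ _ (mscale k (sm_neg (M_val AA)))
  (mscale k (sm_pos (M_val AA)))).
- by rewrite !Rintegral_mscale// /sm_integral/= !mulNr opprK addrC mulrBr.
- by move=> F mF; rewrite /mscale/= fin_numM// fn.
- by move=> F mF; rewrite /mscale/= fin_numM// fp.
- move=> F mF; apply: etrans (smZ _ _ _) _; rewrite sm_posB_neg//.
  by apply: muleBN_fin; [exact: fp|exact: fn].
- exact: (integrable_pos_M_ev (a *: AA : M_set R (M R X))).
- exact: (integrable_neg_M_ev (a *: AA : M_set R (M R X))).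
- exact: integrable_mscale.
- exact: integrable_mscale.
Qed.

Lemma kappa_delta u : kappa (delta R u) = u.
Proof.
apply: M_ext => E mE; apply: etrans (kappaE _ mE) _.
rewrite -[RHS](fineK (sm_fin _ mE)); congr EFin.
have mev : measurable_fun setT (EFin \o @M_ev R X E).
  by apply/measurable_EFinP; exact: measurable_M_ev.
rewrite (@sm_integral_decomp _ _ _ _ (@dirac _ (M R X) u R) mzero).
- rewrite /Rintegral integral_dirac// diracT mul1e.
  by rewrite integral_measure_zero subr0.
- by move=> F mF; rewrite /= diracE.
- by move=> F mF.
- move=> F mF; apply: etrans (sm_diracE _ _ mF) _.
  by apply/esym; exact: sube0.
- exact: integrable_pos_M_ev.
- exact: integrable_neg_M_ev.
- apply/integrableP; split => //.
  rewrite integral_dirac ?diracT ?mul1e ?ltry//.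
  exact: measurableT_comp.
- by apply/integrableP; split => //; rewrite integral_measure_zero.
Qed.

Context (Y : bornMeas) (f : bm_hom X Y).

Lemma M_mapD u v : M_map f (u + v : M_set R X) = (M_map f u + M_map f v : M_set R Y).
Proof.
apply: M_ext => E mE; apply: etrans (direct_imageE _ _ mE) _.
apply: etrans (smD _ _ _) _; apply: etrans; last by apply/esym; exact: smD.
by rewrite -!(direct_imageE (bm_measurable f) _ mE).
Qed.

Lemma M_mapZ a u : M_map f (a *: u : M_set R X) = (a *: M_map f u : M_set R Y).
Proof.
apply: M_ext => E mE; apply: etrans (direct_imageE _ _ mE) _.
apply: etrans (smZ _ _ _) _; apply: etrans; last by apply/esym; exact: smZ.
by rewrite -!(direct_imageE (bm_measurable f) _ mE).
Qed.

Lemma M_map_delta x : M_map f (delta R x) = delta R (f x).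
Proof.
apply: M_ext => E mE; apply: etrans (direct_imageE _ _ mE) _.
apply: etrans (sm_diracE _ _ _) _; last by apply/esym; exact: sm_diracE.
rewrite -[X in measurable X]setTI; exact: bm_measurable.
Qed.

End kappa_linear.

Lemma M_map_id (R : realType) (X : bornMeas) (mu : M R X) :
  M_map (bm_id X) mu = mu.
Proof. by apply: M_ext => E mE; apply: etrans (direct_imageE _ _ mE) _. Qed.

Lemma M_map_comp (R : realType) (X Y Z : bornMeas) (g : bm_hom Y Z)
    (f : bm_hom X Y) (mu : M R X) :
  M_map (bm_comp g f) mu = M_map g (M_map f mu).
Proof.
apply: M_ext => E mE; apply: etrans (direct_imageE _ _ mE) _.
apply/esym; apply: etrans (direct_imageE _ _ mE) _.
apply: direct_imageE; rewrite -[X in measurable X]setTI.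
exact: bm_measurable.
Qed.

Section M_algebra.
Context (R : realType).

Record M_algebra := MAlgebra {
  alg_sort :> bornMeas ;
  alg_str : bm_hom (M R alg_sort) alg_sort ;
  alg_delta : forall x, alg_str (delta R x) = x ;
  alg_kappa : forall MM : M R (M R alg_sort),
    alg_str (M_map alg_str MM) = alg_str (kappa MM) }.

Record M_hom (A B : M_algebra) := MHom {
  mh_fun :> bm_hom A B ;
  mh_alg : forall mu : M R A,
    mh_fun (alg_str A mu) = alg_str B (M_map mh_fun mu) }.

Lemma M_hom_ext (A B : M_algebra) (f g : M_hom A B) :
  (forall x, f x = g x) -> f = g.
Proof.
case: f g => [f mf] [g mg] /= /funext/bm_hom_ext fg; subst g.
by rewrite (Prop_irrelevance mf mg).
Qed.

Definition M_hom_id (A : M_algebra) : M_hom A A.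
Proof. by exists (bm_id A) => mu; rewrite M_map_id. Defined.

Definition M_hom_comp (A B C : M_algebra) (g : M_hom B C) (f : M_hom A B) :
  M_hom A C.
Proof.
by exists (bm_comp g f) => mu; rewrite M_map_comp -mh_alg -mh_alg.
Defined.

(* Alias of the carrier of [A], on which the vector space structure induced by
   the structure map is declared ([alg_addE], [alg_scaleE]). *)
Definition alg_vect (A : M_algebra) : Type := A.

Section alg_vect.
Context (A : M_algebra).
Local Notation c := (alg_str A).
Implicit Types (u v : M_set R A) (x y z : alg_vect A).

Definition alg_zero : alg_vect A := c (0 : M_set R A).
Definition alg_add x y : alg_vect A := c (delta R x + delta R y : M_set R A).
Definition alg_scale (a : R) x : alg_vect A := c (a *: delta R x : M_set R A).
Definition alg_opp x : alg_vect A := alg_scale (- 1) x.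

Lemma alg_strD u v : c (u + v : M_set R A) = alg_add (c u) (c v).
Proof.
rewrite /alg_add.
have /esym := alg_kappa (delta R (u : M R A) + delta R (v : M R A) : M_set R (M R A)).
rewrite kappaD !kappa_delta => ->.
by rewrite M_mapD !M_map_delta.
Qed.

Lemma alg_strZ a u : c (a *: u : M_set R A) = alg_scale a (c u).
Proof.
rewrite /alg_scale.
have /esym := alg_kappa (a *: delta R (u : M R A) : M_set R (M R A)).
rewrite kappaZ !kappa_delta => ->.
by rewrite M_mapZ !M_map_delta.
Qed.

Let alg_ex x : exists u, x = c u.
Proof. by exists (delta R x); rewrite alg_delta. Qed.

Lemma alg_addA : associative alg_add.
Proof.
move=> x y z; have [u ->] := alg_ex x; have [v ->] := alg_ex y.
have [w ->] := alg_ex z.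
by rewrite -!alg_strD addrA.
Qed.

Lemma alg_addC : commutative alg_add.
Proof.
by move=> x y; rewrite /alg_add addrC.
Qed.

Lemma alg_add0 : left_id alg_zero alg_add.
Proof. by move=> x; have [u ->] := alg_ex x; rewrite -!alg_strD add0r. Qed.

Lemma alg_addN : left_inverse alg_zero alg_opp alg_add.
Proof.
move=> x; have [u ->] := alg_ex x.
by rewrite /alg_opp -alg_strZ -alg_strD scaleN1r addNr.
Qed.

Lemma alg_scaleA a b x : alg_scale a (alg_scale b x) = alg_scale (a * b) x.
Proof. by have [u ->] := alg_ex x; rewrite -!alg_strZ scalerA. Qed.

Lemma alg_scale1 : left_id 1 alg_scale.
Proof. by move=> x; have [u ->] := alg_ex x; rewrite -!alg_strZ scale1r. Qed.

HB.instance Definition _ := Choice.on (alg_vect A).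
HB.instance Definition _ := GRing.isZmodule.Build (alg_vect A)
  alg_addA alg_addC alg_add0 alg_addN.

Lemma alg_scaleDr : right_distributive alg_scale +%R.
Proof.
move=> a x y; have [u ->] := alg_ex x; have [v ->] := alg_ex y.
by rewrite -[X in alg_scale _ X]alg_strD -!alg_strZ scalerDr alg_strD.
Qed.

Lemma alg_scaleDl x a b : alg_scale (a + b) x = alg_scale a x + alg_scale b x.
Proof. by have [u ->] := alg_ex x; rewrite -!alg_strZ scalerDl alg_strD. Qed.

HB.instance Definition _ := GRing.Zmodule_isLmodule.Build R (alg_vect A)
  alg_scaleA alg_scale1 alg_scaleDr alg_scaleDl.

Lemma alg_addE x y : x + y = c (delta R x + delta R y : M_set R A).
Proof. by []. Qed.

Lemma alg_scaleE a x : a *: x = c (a *: delta R x : M_set R A).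
Proof. by []. Qed.

End alg_vect.

Lemma M_hom_linear (A B : M_algebra) (f : M_hom A B) :
  linear (f : alg_vect A -> alg_vect B).
Proof.
have fD (x y : alg_vect A) : f (x + y) = (f x : alg_vect B) + f y.
  by rewrite !alg_addE mh_alg M_mapD !M_map_delta.
have fZ a (x : alg_vect A) : f (a *: x) = a *: (f x : alg_vect B).
  by rewrite !alg_scaleE mh_alg M_mapZ !M_map_delta.
by move=> a x y; rewrite fD fZ.
Qed.

End M_algebra.

Section convex_bvs.
Context (R : realType).

Definition is_bvs (V : lmodType R) (BV : bornology V) :=
  bornological (prod_bornology BV BV) BV (fun xy => xy.1 + xy.2) /\
  bornological (prod_bornology (real_bornology R) BV) BV (fun ax => ax.1 *: ax.2).

Definition is_convex_bornology (V : lmodType R) (BV : bornology V) :=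
  forall A, BV A -> exists C : set (convex_lmodType V),
    [/\ convex_set C, BV C & A `<=` C].

Record convBvs := ConvBvs {
  cb_vect :> lmodType R ;
  cb_born : bornology cb_vect ;
  cb_bvs : is_bvs cb_born ;
  cb_convex : is_convex_bornology cb_born }.

Record cb_hom (V W : convBvs) := CbHom {
  cbh_fun :> {linear V -> W} ;
  cbh_bornological : bornological (cb_born V) (cb_born W) cbh_fun }.

End convex_bvs.

Record category := Category {
  cat_obj :> Type ;
  cat_hom : cat_obj -> cat_obj -> Type ;
  cat_id : forall a, cat_hom a a ;
  cat_comp : forall a b c, cat_hom b c -> cat_hom a b -> cat_hom a c ;
  cat_idl : forall a b (f : cat_hom a b), cat_comp (cat_id b) f = f ;
  cat_idr : forall a b (f : cat_hom a b), cat_comp f (cat_id a) = f ;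
  cat_compA : forall a b c d (h : cat_hom c d) (g : cat_hom b c)
    (f : cat_hom a b), cat_comp h (cat_comp g f) = cat_comp (cat_comp h g) f }.

Record functor (C D : category) := Functor {
  fun_obj :> C -> D ;
  fun_hom : forall a b, cat_hom a b -> cat_hom (fun_obj a) (fun_obj b) ;
  fun_id : forall a, fun_hom (cat_id a) = cat_id (fun_obj a) ;
  fun_comp : forall a b c (g : cat_hom b c) (f : cat_hom a b),
    fun_hom (cat_comp g f) = cat_comp (fun_hom g) (fun_hom f) }.

Definition functor_comp (C D E : category) (G : functor D E) (F : functor C D) :
  functor C E.
Proof.
exists (fun a => G (F a)) (fun a b f => fun_hom G (fun_hom F f)).
- by move=> a; rewrite !fun_id.
- by move=> a b c g f; rewrite !fun_comp.
Defined.

Section born_category.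

Record bornSet := BornSet {
  bs_sort :> Type ;
  bs_born : bornology bs_sort }.

Record born_hom (X Y : bornSet) := BornHom {
  bh_fun :> X -> Y ;
  bh_bornological : bornological (bs_born X) (bs_born Y) bh_fun }.

Lemma born_hom_ext (X Y : bornSet) (f g : born_hom X Y) : f =1 g -> f = g.
Proof.
case: f g => [f bf] [g bg] /= /funext fg; subst g.
by rewrite (Prop_irrelevance bf bg).
Qed.

Definition born_id (X : bornSet) : born_hom X X.
Proof. by exists id => A bA; rewrite image_id. Defined.

Definition born_comp (X Y Z : bornSet) (g : born_hom Y Z) (f : born_hom X Y) :
  born_hom X Z.
Proof.
exists (g \o f) => A bA; rewrite -image_comp.
exact/(bh_bornological g)/(bh_bornological f).
Defined.

Definition BornCat : category.
Proof.
by exists bornSet born_hom born_id born_comp => *; apply: born_hom_ext.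
Defined.

End born_category.

Section categories.
Context (R : realType).

Lemma linear_ext (V W : lmodType R) (f g : {linear V -> W}) : f =1 g -> f = g.
Proof.
case: f g => [f [[f1] [f2]]] [g [[g1] [g2]]] /= /funext fg; subst g.
by rewrite (Prop_irrelevance f1 g1) (Prop_irrelevance f2 g2).
Qed.

Lemma cb_hom_ext (V W : convBvs R) (f g : cb_hom V W) : f =1 g -> f = g.
Proof.
case: f g => [f bf] [g bg] /= /linear_ext fg; subst g.
by rewrite (Prop_irrelevance bf bg).
Qed.

Definition cb_id (V : convBvs R) : cb_hom V V.
Proof. by exists idfun => A bA; rewrite image_id. Defined.

Definition cb_comp (U V W : convBvs R) (g : cb_hom V W) (f : cb_hom U V) :
  cb_hom U W.
Proof.
exists (g \o f) => A bA; rewrite -image_comp.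
exact/(cbh_bornological g)/(cbh_bornological f).
Defined.

Definition VectCat : category.
Proof.
exists (lmodType R) (fun V W : lmodType R => {linear V -> W})
  (fun V : lmodType R => (idfun : {linear V -> V}))
  (fun (U V W : lmodType R) (g : {linear V -> W}) (f : {linear U -> V}) =>
    (g \o f : {linear U -> W})) => *; exact: linear_ext.
Defined.

Definition ConvBvsCat : category.
Proof. by exists (convBvs R) (@cb_hom R) cb_id cb_comp => *; exact: cb_hom_ext. Defined.

Definition MAlgCat : category.
Proof.
by exists (M_algebra R) (@M_hom R) (@M_hom_id R) (@M_hom_comp R) => *;
  exact: M_hom_ext.
Defined.

Definition alg_linear (A B : M_algebra R) (f : M_hom A B) :
  {linear alg_vect A -> alg_vect B} :=
  HB.pack (f : alg_vect A -> alg_vect B)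
    (GRing.isLinear.Build R (alg_vect A) (alg_vect B) *:%R f (M_hom_linear f)).

Definition MAlg_to_Vect : functor MAlgCat VectCat.
Proof.
exists (fun A : MAlgCat => (alg_vect A : lmodType R) : VectCat)
  (fun A B f => alg_linear f).
- by move=> A; exact: linear_ext.
- by move=> A B C g f; exact: linear_ext.
Defined.

Definition MAlg_to_Born : functor MAlgCat BornCat.
Proof.
exists (fun A : MAlgCat => BornSet (bm_born (A : M_algebra R)) : BornCat)
  (fun (A B : M_algebra R) (f : M_hom A B) =>
    @BornHom (BornSet (bm_born A)) (BornSet (bm_born B)) f (bm_bornological f)).
- by move=> A; exact: born_hom_ext.
- by move=> A B C g f; exact: born_hom_ext.
Defined.

Definition ConvBvs_to_Vect : functor ConvBvsCat VectCat.
Proof.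
by exists (fun V : ConvBvsCat => cb_vect V : VectCat)
  (fun V W f => cbh_fun f).
Defined.

Definition ConvBvs_to_Born : functor ConvBvsCat BornCat.
Proof.
exists (fun V : ConvBvsCat => BornSet (cb_born V) : BornCat)
  (fun (V W : convBvs R) (f : cb_hom V W) =>
    @BornHom (BornSet (cb_born V)) (BornSet (cb_born W)) f (cbh_bornological f)).
- by move=> V; exact: born_hom_ext.
- by move=> U V W g f; exact: born_hom_ext.
Defined.

End categories.

(* Main.v *)
Require Import Defs.
From mathcomp Require Import all_boot all_order all_algebra.
From mathcomp Require Import all_classical all_reals all_analysis.

(** Each formula for an operation of [alg_vect A] reads: take a combination of
    Dirac measures, then apply the structure map [alg_str A].  Since that map
    is bornological, it is enough to find bounded sets of measures containing
    these combinations.  The bounded sets of [M R A] are those contained in a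
    set [M_ball B gamma], so everything reduces to the fact that the total
    variation norm is subadditive and absolutely homogeneous
    ([sm_norm_triangle], [sm_norm_scale]) and is at most 1 on Dirac measures
    ([sm_norm_dirac]).

    For instance, if [x] and [y] range over bounded sets [B] and [C], then
    [delta x + delta y] ranges over a subset of [M_ball (B `|` C) 2], whose
    image is bounded and contains all sums [x + y].

    For convexity, a bounded set [B] is contained in the image of the ball
    [M_ball B 1], because [x] is the image of [delta x].  The ball is convex,
    again by the norm properties, and the structure map is linear, so this image
    is a convex bounded set.

    The factorization is then formal: homomorphisms of algebras are linear and
    bornological, and a functor is determined by its action on objects and
    morphisms. *)

Set Implicit Arguments.
Unset Strict Implicit.
Unset Printing Implicit Defensive.

Import Order.TTheory GRing.Theory Num.Theory.

Local Open Scope classical_set_scope.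
Local Open Scope ring_scope.

Section total_variation_norm.
Context d (T : measurableType d) (R : realType).
Implicit Types (mu nu : signed_measure T R).

(** The norm of [mu] is the maximum of [mu P - mu N] over the disjoint pairs
    [(P, N)]: this lemma is the upper bound, and [sm_norm_attained] says that a
    Hahn decomposition attains it.  This description is linear in [mu] for
    fixed [(P, N)], which gives the norm properties without comparing the Hahn
    decompositions of different measures. *)
Lemma le_sm_norm_disjoint mu (P N : set T) :
  measurable P -> measurable N -> P `&` N = set0 ->
  `|ev P mu - ev N mu| <= sm_norm mu.
Proof.
move=> mP mN PN0; rewrite -lee_fin.
have evE E : measurable E -> `|ev E mu|%:E = `|mu E|%E.
  by move=> mE; rewrite -[in RHS](fineK (sm_fin mu mE)).
apply: (@le_trans _ _ (`|mu P| + `|mu N|)%E).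
  by rewrite -!evE// -EFinD lee_fin; exact: ler_normB.
apply: (@le_trans _ _ (Defs.total_variation mu (P `|` N))).
  by rewrite /Defs.total_variation measureU//; apply: leeD; exact: abse_charge_variation.
rewrite /sm_norm fineK; last exact: fin_num_measure.
by apply: le_measure; rewrite ?inE//; exact: measurableU.
Qed.

Lemma sm_norm_attained mu : exists PN : set T * set T,
  [/\ measurable PN.1, measurable PN.2, PN.1 `&` PN.2 = set0 &
      sm_norm mu = ev PN.1 mu - ev PN.2 mu].
Proof.
have [[mP _] [mN _] _ PN0] := svalP (hahn_sets mu).
exists (sval (hahn_sets mu)); split => //.
rewrite /sm_norm /Defs.total_variation /charge_variation/=.
rewrite jordan_posE cjordan_posE jordan_negE cjordan_negE.
rewrite /crestr0 mem_set// /crestr !setTI.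
by rewrite fineD ?fin_numN ?sm_fin// fineN.
Qed.

Lemma sm_norm_triangle mu nu : sm_norm (mu + nu) <= sm_norm mu + sm_norm nu.
Proof.
have [[P N] [/= mP mN PN0 ->]] := sm_norm_attained (mu + nu).
have evD E : measurable E -> ev E (mu + nu) = ev E mu + ev E nu.
  by move=> mE; rewrite /ev smD fineD// sm_fin.
rewrite !evD// opprD addrACA.
by apply: lerD; apply: le_trans (ler_norm _) _; exact: le_sm_norm_disjoint.
Qed.

Lemma sm_norm_scale a mu : sm_norm (a *: mu) <= `|a| * sm_norm mu.
Proof.
have [[P N] [/= mP mN PN0 ->]] := sm_norm_attained (a *: mu).
have evZ E : measurable E -> ev E (a *: mu) = a * ev E mu.
  by move=> mE; rewrite /ev smZ fineM// sm_fin.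
rewrite !evZ// -mulrBr; apply: le_trans (ler_norm _) _.
by rewrite normrM ler_wpM2l// le_sm_norm_disjoint.
Qed.

Lemma sm_norm_dirac (x : T) : sm_norm (sm_dirac R x) <= 1.
Proof.
have [[P N] [/= mP mN PN0 ->]] := sm_norm_attained (sm_dirac R x).
rewrite /ev !sm_diracE// !diracE/=.
by rewrite lerBlDr (@le_trans _ _ 1)// ?lerDl// lern1 leq_b1.
Qed.

End total_variation_norm.

Section balls.
Context (R : realType) (X : bornMeas).
Implicit Types (u v : M_set R X) (B C : set X) (g h : R).

Lemma M_ball_delta B x : B x -> M_ball B 1 (delta R x : M_set R X).
Proof.
move=> Bx; split; last exact: sm_norm_dirac.
by apply: supported_by_subset (supported_by_dirac R x) => _ ->.
Qed.

Lemma M_ballD B C g h u v :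
  M_ball B g u -> M_ball C h v -> M_ball (B `|` C) (g + h) (u + v).
Proof.
move=> [uB ug] [vC vh]; split; first exact: supported_byD.
by apply: le_trans (sm_norm_triangle _ _) _; exact: lerD.
Qed.

Lemma M_ballZ B g h a u : `|a| <= h -> M_ball B g u -> M_ball B (h * g) (a *: u).
Proof.
move=> ah [uB ug]; split; first exact: supported_byZ.
apply: le_trans (sm_norm_scale _ _) _; apply: ler_pM => //.
exact/fine_ge0/(measure_ge0 (charge_variation _)).
Qed.

Lemma M_ball_convex B g : @convex_set R (M_set R X) (M_ball B g).
Proof.
move=> u v p; rewrite !inE => uB vB.
rewrite [X in M_ball _ X](_ : g = p%:num * g + (1 - p%:num) * g); last first.
  by rewrite -mulrDl addrC subrK mul1r.
rewrite -[B]setUid; apply: M_ballD; apply: M_ballZ => //.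
  by rewrite ger0_norm.
by rewrite ger0_norm// subr_ge0.
Qed.

End balls.

Section algebra.
Context (R : realType) (A : M_algebra R).
Local Notation c := (alg_str A).

Lemma alg_bdd_ball_image B g : bm_born A B -> 0 <= g ->
  bm_born A (c @` M_ball B g).
Proof. by move=> bB g0; apply: (bm_bornological c); exists B, g; split. Qed.

Lemma alg_add_bornological :
  bornological (prod_bornology (bm_born A) (bm_born A)) (bm_born A)
    (fun xy : alg_vect A * alg_vect A => xy.1 + xy.2).
Proof.
move=> S [b1 b2].
apply: bdd_subset (alg_bdd_ball_image (bddU b1 b2) (addr_ge0 ler01 ler01)).
move=> _ [[x y] Sxy <-]; rewrite alg_addE/=.
exists (delta R (x : A) + delta R (y : A) : M_set R A) => //.
by apply: M_ballD; apply: M_ball_delta; exists (x, y).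
Qed.

Lemma alg_scale_bornological :
  bornological (prod_bornology (real_bornology R) (bm_born A)) (bm_born A)
    (fun ax : R * alg_vect A => ax.1 *: ax.2).
Proof.
move=> S [[m [_ mS]] b2].
pose k := Num.max 0 m + 1.
have k0 : 0 <= k by rewrite addr_ge0// le_max lexx.
have mk : m < k by rewrite ltr_pwDr// le_max lexx orbT.
apply: bdd_subset (alg_bdd_ball_image b2 (mulr_ge0 k0 ler01)).
move=> _ [[a x] Sax <-]; rewrite alg_scaleE/=.
exists (a *: (delta R (x : A) : M_set R A)) => //.
apply: M_ballZ; last by apply: M_ball_delta; exists (a, x).
by apply: (mS _ mk); exists (a, x).
Qed.

Lemma alg_is_bvs : @is_bvs R (alg_vect A) (bm_born A).
Proof. by split; [exact: alg_add_bornological|exact: alg_scale_bornological]. Qed.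

Lemma alg_is_convex : @is_convex_bornology R (alg_vect A) (bm_born A).
Proof.
move=> B bB; exists (c @` M_ball B 1); split.
- move=> x y p; rewrite !inE => -[u uB <-] [v vB <-].
  have := @M_ball_convex R A B 1 u v p.
  rewrite !inE => /(_ uB vB) uvB; exists (p%:num *: u + (1 - p%:num) *: v) => //.
  by rewrite alg_strD !alg_strZ.
- exact: alg_bdd_ball_image.
- by move=> x Bx; exists (delta R (x : A)); [exact: M_ball_delta|exact: alg_delta].
Qed.

Definition alg_convBvs : convBvs R := ConvBvs alg_is_bvs alg_is_convex.

End algebra.

Definition MAlg_to_ConvBvs (R : realType) : functor (MAlgCat R) (ConvBvsCat R).
Proof.
exists (fun A : MAlgCat R => alg_convBvs A : ConvBvsCat R)
  (fun (A B : M_algebra R) (f : M_hom A B) =>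
    @CbHom R (alg_convBvs A) (alg_convBvs B) (alg_linear f) (bm_bornological f)).
- by move=> A; exact: cb_hom_ext.
- by move=> A B C g f; exact: cb_hom_ext.
Defined.

(** The action on objects is shared, so that no transport along an equality of
    objects is needed to compare the actions on morphisms. *)
Lemma functor_irrelevance (C D : category) (F : C -> D)
    (h : forall a b, cat_hom a b -> cat_hom (F a) (F b)) i i' k k' :
  @Functor C D F h i k = @Functor C D F h i' k'.
Proof. by rewrite (Prop_irrelevance i i') (Prop_irrelevance k k'). Qed.

Theorem theorem11p7 (R : realType) :
  (forall A : M_algebra R,
     @is_bvs R (alg_vect A) (bm_born A) /\
     @is_convex_bornology R (alg_vect A) (bm_born A)) /\
  exists G : functor (MAlgCat R) (ConvBvsCat R),
    functor_comp (ConvBvs_to_Vect R) G = MAlg_to_Vect R /\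
    functor_comp (ConvBvs_to_Born R) G = MAlg_to_Born R.
Proof.
split; first by move=> A; split; [exact: alg_is_bvs|exact: alg_is_convex].
by exists (MAlg_to_ConvBvs R); split; exact: functor_irrelevance.
Qed.
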